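(* Let $\mathcal{G}$ be a causal graph (a finite directed acyclic graph) on nodes $\{1,\dots,d\}$. Consider a VACA model over $\mathcal{G}$ whose decoder is a message passing GNN. Let $\gamma$ be the length of the longest path between any two endogenous nodes in $\mathcal{G}$. Then VACA captures causal interventions if and only if the number of hidden layers in its decoder is greater than or equal to $\gamma-1$.
   Context: Graph notation. $\mathcal{G}$ is a finite directed acyclic graph on $\{1,\dots,d\}$, where node $i$ corresponds to the endogenous variable $X_i$. An edge $(j,i)$ means that $j$ is a parent of $i$, and $\mathcal{N}_i=\mathrm{pa}(i)$ is the set of parents (neighbors) of $i$. A path $p(u,v)$ from $u$ to $v$ is an ordered sequence of distinct nodes $(u,w_1,\dots,w_{n-1},v)$ with an edge from each node to the next; its length $|p(u,v)|=n$ is its number of edges. $P(u,v)$ is the set of all paths from $u$ to $v$. For $u,v$ with $P(u,v)\neq\varnothing$, $d^+(u,v)$ is the maximal length of a path from $u$ to $v$, and $\gamma=\max_{u,v}d^+(u,v)$ over such pairs. Message passing GNN. A GNN with $L\ge1$ layers has $N_h=L-1$ hidden layers. Given input features $h_i^0$ for each node $i$, layer $l=1,\dots,L$ computes, for every node $i$, $$h_i^l=f^u\big(h_i^{l-1},\,f^a(\{f^m(h_i^{l-1},h_j^{l-1};\theta_m^l): j\in\mathcal{N}_i\});\theta_u^l\big),$$ with message function $f^m$, aggregation function $f^a$ and update function $f^u$. The output for node $i$ is $h_i^L$. VACA. VACA over $\mathcal{G}$ has one latent variable $Z_i$ per node. Its decoder is a message passing GNN on $\mathcal{G}$ with input features $h_i^0=Z_i$,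 whose output at node $i$ gives the parameters of the likelihood of $X_i$. An intervention on node $i$ in VACA is performed by removing all edges into $i$ (so $\mathcal{N}_i=\varnothing$), leaving all other edges untouched. Capturing causal interventions. For nodes $j,i$, let $P_{\mathrm{GNN}}(j,i)\subseteq P(j,i)$ be the set of paths through which the output feature of node $i$ receives information from node $j$ in the decoder. That is, $P_{\mathrm{GNN}}(j,i)$ consists of the paths $(j=w_0,w_1,\dots,w_n=i)$ for which there are layers $1\le l_1<\dots<l_n\le L$ such that the message from $w_{k-1}$ to $w_k$ is sent in layer $l_k$, $k=1,\dots,n$ (between these layers the information is retained through the node's own previous state in the update). VACA captures causal interventions if its decoder models all causal paths, i.e. $P_{\mathrm{GNN}}(j,i)=P(j,i)$ for all nodes $i,j$. *)

(* Defs.v *)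
From HB Require Import structures.
From mathcomp Require Import all_boot all_order all_algebra.
From mathcomp Require Import all_classical all_reals all_analysis.
Set Implicit Arguments.
Unset Strict Implicit.
Unset Printing Implicit Defensive.

Local Open Scope classical_set_scope.
Local Open Scope nat_scope.

(* [cycle edge c] also holds for closed walks with repeated nodes, so [acyclic]
   excludes self-loops as well as longer directed cycles. *)
Record dag (d : nat) := Dag {
  edge :> rel 'I_d;
  acyclic : forall c : seq 'I_d, c != [::] -> ~~ cycle edge c }.

Section Graph.
Context {d : nat} (G : dag d).
Implicit Types (u v i j : 'I_d) (p : seq 'I_d).

Definition pa i : {set 'I_d} := [set j | edge G j i].

(* A path is stored with both of its endpoints: [:: u; w_1; ...; w_(n-1); v].
   The one-node sequence [:: u] is the path of length 0 from u to u. *)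
Definition paths u v : set (seq 'I_d) :=
  [set p | exists s, [/\ p = u :: s, path (edge G) u s, last u s = v & uniq p]].

Definition path_length p : nat := (size p).-1.

(* The nodes of a path are distinct, so its length is less than d and the bound
   on n discards nothing. *)
Definition dplus u v : nat :=
  \max_(n < d | `[< exists2 p, paths u v p & path_length p = n >]) n.

Definition gamma : nat :=
  \max_(u : 'I_d) \max_(v : 'I_d | `[< paths u v !=set0 >]) dplus u v.

End Graph.

(* The feature, message and aggregate spaces may change from layer to layer, so
   each of the three functions is a family over layers.  The index is shifted:
   [fm l], [fa l], [fu l] are those of layer l.+1, which maps [feat l] to
   [feat l.+1]; only the indices l < nlayers are used by the network. *)
Record gnn := Gnn {
  nlayers : nat;
  nlayers_gt0 : 0 < nlayers;
  feat : nat -> Type;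
  msg : nat -> eqType;
  aggr : nat -> Type;
  param_m : nat -> Type;
  param_u : nat -> Type;
  theta_m : forall l, param_m l;
  theta_u : forall l, param_u l;
  fm : forall l, feat l -> feat l -> param_m l -> msg l;
  fa : forall l, seq (msg l) -> aggr l;
  (* the argument of [fa] is an unordered collection of messages *)
  fa_perm : forall l (s t : seq (msg l)), perm_eq s t -> fa s = fa t;
  fu : forall l, feat l -> aggr l -> param_u l -> feat l.+1 }.

Definition nhidden (D : gnn) : nat := nlayers D - 1.

Section MessagePassing.
Context {d : nat} (G : dag d) (D : gnn).

Fixpoint node_features (h0 : 'I_d -> feat D 0) (l : nat) : 'I_d -> feat D l :=
  match l return 'I_d -> feat D l with
  | 0 => h0
  | k.+1 => fun i =>
      let h := node_features h0 k in
      fu (h i)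
         (fa [seq fm (h i) (h j) (theta_m D k) | j <- enum (pa G i)])
         (theta_u D k)
  end.

Definition gnn_output (h0 : 'I_d -> feat D 0) : 'I_d -> feat D (nlayers D) :=
  node_features h0 (nlayers D).

(* Layers are numbered from 1 here.  In each of them, node i receives exactly
   one message from each of its parents: see [node_features]. *)
Definition message_sent (l : nat) (j i : 'I_d) : Prop :=
  (1 <= l <= nlayers D) /\ j \in pa G i.

(* [nth 0 ls k] is the layer l_(k+1), in which the edge (w_k, w_(k+1)) is used;
   both defaults of [nth] are out of reach. *)
Definition gnn_paths (j i : 'I_d) : set (seq 'I_d) :=
  [set p | paths G j i p /\
     exists ls : seq nat,
       [/\ size ls = path_length p, sorted ltn ls &
           forall k, k < path_length p ->
             message_sent (nth 0 ls k) (nth j p k) (nth j p k.+1)]].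

End MessagePassing.

(* The latent variables Z_i take values in [feat decoder 0]. *)
Record vaca (R : realType) (d : nat) (G : dag d) := Vaca {
  decoder : gnn;
  endo_disp : 'I_d -> measure_display;
  endo : forall i, measurableType (endo_disp i);
  likelihood : forall i : 'I_d,
    feat decoder (nlayers decoder) -> probability (endo i) R }.

Definition decode (R : realType) (d : nat) (G : dag d) (V : vaca R G)
    (z : 'I_d -> feat (decoder V) 0) (i : 'I_d) : probability (endo V i) R :=
  likelihood i (gnn_output G z i).

Definition captures_causal_interventions (R : realType) (d : nat) (G : dag d)
    (V : vaca R G) : Prop :=
  forall i j : 'I_d, gnn_paths G (decoder V) j i = paths G j i.

(* Main.v *)
Require Import Defs.
From mathcomp Require Import all_boot all_order all_algebra.
From mathcomp Require Import all_classical all_reals all_analysis.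
Set Implicit Arguments.
Unset Strict Implicit.
Unset Printing Implicit Defensive.

(* The layers carrying the successive messages of a path are distinct, so a
   path of length n needs n of the L layers; conversely layers 1, ..., n carry
   it.  Hence all paths are captured iff the longest one has length at most L,
   and L >= 1 makes this equivalent to gamma - 1 <= L - 1, also when gamma = 0. *)

(** Distinct nodes number at most [d]. This lets a path length serve as an index of the maximum in
    [dplus]. *)
Lemma path_length_ltn (d : nat) (G : dag d) (u v : 'I_d) (p : seq 'I_d) :
  paths G u v p -> (path_length p < d)%N.
Proof.
case=> s [-> _ _ /card_uniqP us]; rewrite /path_length /=.
by have := max_card (mem (u :: s)); rewrite us card_ord.
Qed.

Lemma gamma_leqP (d : nat) (G : dag d) (m : nat) :
  (gamma G <= m)%N <->
  forall (u v : 'I_d) (p : seq 'I_d), paths G u v p -> (path_length p <= m)%N.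
Proof.
split=> [/bigmax_leqP gm u v p puv | pm].
  have puv_ne : `[< exists q, paths G u v q >] by apply/asboolP; exists p.
  have /bigmax_leqP/(_ v puv_ne) := gm u isT.
  move=> /bigmax_leqP/(_ (Ordinal (path_length_ltn puv))); apply.
  by apply/asboolP; exists p.
apply/bigmax_leqP => u _; apply/bigmax_leqP => v _; apply/bigmax_leqP => n.
by move=> /asboolP[p puv <-]; apply: pm puv.
Qed.

Lemma gnn_pathsP (d : nat) (G : dag d) (D : gnn) (j i : 'I_d) (p : seq 'I_d) :
  gnn_paths G D j i p <-> paths G j i p /\ (path_length p <= nlayers D)%N.
Proof.
split=> [[pji [ls [szls ls_sorted sent]]] | [pji pL]]; split=> //.
  (* Pigeonhole: [ls] increases strictly, so it is a repetition-free list of elements of 1, ...,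
     L. *)
  rewrite -szls -(size_iota 1 (nlayers D)); apply: uniq_leq_size.
    exact: sorted_uniq ltn_trans ltnn _ ls_sorted.
  move=> l /(nthP 0)[k]; rewrite szls => /sent[lL _] <-.
  by rewrite mem_iota add1n ltnS.
exists (iota 1 (path_length p)); split; [exact: size_iota|exact: iota_ltn_sorted|].
move=> k kp; split; first by rewrite nth_iota // add1n /= (leq_trans kp).
(* The default [j] in [pathP] matches the one in [gnn_paths]; the k-th entry of [s] is entry k+1 of
   the path. *)
case: pji kp {pL} => s [-> /(pathP j) es _ _] ks.
by rewrite inE; apply: es.
Qed.

Theorem proposition2 (R : realType) (d : nat) (G : dag d) (V : vaca R G) :
  captures_causal_interventions V <-> (gamma G - 1 <= nhidden (decoder V))%N.
Proof.
rewrite /nhidden leq_subLR subnKC ?nlayers_gt0 // gamma_leqP.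
split=> [cap u v p puv | pL i j].
  by have /gnn_pathsP[] : gnn_paths G (decoder V) u v p by rewrite cap.
apply/seteqP; split=> p; first by case/gnn_pathsP.
by move=> pji; apply/gnn_pathsP; split=> //; apply: pL pji.
Qed.
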